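(* Let $Q_k$ be the basis matrix generated by $k-1$ iterations of the infinite Arnoldi method (IAR, Taylor version), and suppose that $a_{i,j,\ell}\in\mathbb{C}$, $i,j,\ell=1,\ldots,k$, and $Z_k=[z_1,\ldots,z_k]\in\mathbb{C}^{n\times k}$ are given such that they represent a factorization of $Q_k$. Then the quantities $y_1,\ldots,y_{k+1},h,y_\perp,\beta,Q_{k+1}$ computed in iteration $k$ of IAR satisfy the following relations. (i) The vectors $y_2,\ldots,y_{k+1}$ satisfy $y_j=\frac{1}{j-1}\tilde y_j$ for $j=2,\ldots,k+1$, where $$[\tilde y_2\ \cdots\ \tilde y_{k+1}]=Z_kA_k,\qquad A_k^T=[a_{i,k,\ell}]_{i,\ell=1}^k .$$ (ii) Suppose $y_1\notin\operatorname{span}(z_1,\ldots,z_k)$. Let $z_{k+1}\in\mathbb{C}^n$ and $t_1,\ldots,t_{k+1}\in\mathbb{C}$ be the result of the Gram–Schmidt process applied to $y_1$ against $z_1,\ldots,z_k$, i.e. such that $$y_1=t_1z_1+\cdots+t_{k+1}z_{k+1}$$ and $Z_{k+1}:=[Z_k,\ z_{k+1}]$ satisfies $Z_{k+1}^HZ_{k+1}=I$. Let $[g_{i,\ell}]_{i,\ell=1}^{k+1}$ be defined by $$g_{1,\ell}:=t_\ell\ (\ell=1,\ldots,k+1),\qquad g_{i,\ell}:=\tfrac{1}{i-1}a_{i-1,k,\ell}\ (i=2,\ldots,k+1,\ \ell=1,\ldots,k),\qquad g_{i,k+1}:=0\ (i=2,\ldots,k+1).$$ Then $$h=\sum_{\ell=1}^k\begin{bmatrix}a_{1,1,\ell}^*&\cdots&a_{k,1,\ell}^*\\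 \vdots&&\vdots\\ a_{1,k,\ell}^*&\cdots&a_{k,k,\ell}^*\end{bmatrix}\begin{bmatrix}g_{1,\ell}\\ \vdots\\ g_{k,\ell}\end{bmatrix}.$$ (iii) With $z_{k+1}$ and $g_{i,\ell}$ as in (ii), let $[f_{i,\ell}]_{i,\ell=1}^{k+1}$ be defined by $$\begin{bmatrix}f_{1,\ell}\\ \vdots\\ f_{k+1,\ell}\end{bmatrix}:=\begin{bmatrix}g_{1,\ell}\\ \vdots\\ g_{k+1,\ell}\end{bmatrix}-\begin{bmatrix}a_{1,1,\ell}&\cdots&a_{1,k,\ell}\\ \vdots&&\vdots\\ a_{k,1,\ell}&\cdots&a_{k,k,\ell}\\ 0&\cdots&0\end{bmatrix}h\quad(\ell=1,\ldots,k),\qquad f_{i,k+1}:=g_{i,k+1}\ (i=1,\ldots,k+1).$$ Then $$y_\perp=\sum_{\ell=1}^{k+1}\begin{bmatrix}f_{1,\ell}\\ \vdots\\ f_{k+1,\ell}\end{bmatrix}\otimes z_\ell .$$ (iv) The scalar $\beta$ satisfies $\beta=\bigl\|[f_{i,\ell}]_{i,\ell=1}^{k+1}\bigr\|_{F}$ (Frobenius norm). Moreover, if $a_{i,j,\ell}$ is expanded by setting $$a_{i,k+1,\ell}=\tfrac1\beta f_{i,\ell}\ (i,\ell=1,\ldots,k+1),\qquad a_{k+1,j,\ell}=0\ (\ell=1,\ldots,k+1,\ j=1,\ldots,k),\qquad a_{i,j,k+1}=0\ (i=1,\ldots,k+1,\ j=1,\ldots,k),$$ then $a_{i,j,\ell}$,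 $i,j,\ell=1,\ldots,k+1$, and $z_1,\ldots,z_{k+1}$ represent a factorization of $Q_{k+1}$.
   Context: Let $M$ be a $\mathbb{C}^{n\times n}$-valued function analytic in a neighborhood of $0$ with $M(0)$ invertible, and let $x_1\in\mathbb{C}^n\setminus\{0\}$. All computations are in exact arithmetic; ${}^*$ denotes complex conjugation of scalars, ${}^H$ conjugate transpose, and $\otimes$ the Kronecker product. Infinite Arnoldi method (IAR, Taylor version), started with $x_1$: set $Q_1=x_1/\|x_1\|_2\in\mathbb{C}^{n\times 1}$ and let $H_0$ be the empty matrix. For $k=1,2,\ldots$, iteration $k$ constructs $Q_{k+1}$ from $Q_k\in\mathbb{C}^{nk\times k}$ as follows. Partition the columns of $Q_k$ into blocks $q_{i,j}\in\mathbb{C}^n$ (block row $i$, column $j$, $i,j=1,\dots,k$; $q_{i,j}=0$ for $i>j$). - Set $y_j=\frac{1}{j-1}q_{j-1,k}$ for $j=2,\ldots,k+1$. - Set $y_1=-M(0)^{-1}\sum_{i=1}^{k}M^{(i)}(0)\,y_{i+1}$. - Let $y\in\mathbb{C}^{n(k+1)}$ be the vector obtained by stacking $y_1,\ldots,y_{k+1}$, and $\underline{Q}_k=\begin{bmatrix}Q_k\\0\end{bmatrix}\in\mathbb{C}^{n(k+1)\times k}$ (one zero block row of height $n$ appended). - Set $h=\underline{Q}_k^Hy$, $y_\perp=y-\underline{Q}_kh$ (this orthogonalization may be repeated, which changes nothing in exact arithmetic), $\beta=\|y_\perp\|_2$, $q_{k+1}=y_\perp/\beta$. - Set $H_k=\begin{bmatrix}H_{k-1}&h\\0&\beta\end{bmatrix}\in\mathbb{C}^{(k+1)\times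 k}$ and $Q_{k+1}=[\underline{Q}_k,\ q_{k+1}]$. Factorization: numbers $a_{i,j,\ell}$ ($i,j,\ell=1,\ldots,k$) and a matrix $Z_k=[z_1,\ldots,z_k]\in\mathbb{C}^{n\times k}$ with orthonormal columns ($Z_k^HZ_k=I$) represent a factorization of $Q_k$ if $z_1,\ldots,z_k$ is a basis of $\operatorname{span}(q_{1,1},\ldots,q_{1,k})$ and $$q_{i,j}=\sum_{\ell=1}^ka_{i,j,\ell}\,z_\ell\qquad\text{for } i,j=1,\ldots,k .$$ *)

(* Defs.v *)
(* A matrix of size k >= 1 in the mathematics is one of size k.+1 here, and the
   1-based indices 1, ..., k.+1 are the elements of 'I_k.+1. *)
From HB Require Import structures.
From mathcomp Require Import all_boot all_order all_algebra.
From mathcomp Require Import all_classical all_reals all_analysis.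
From mathcomp Require Import complex mxtens.

Set Implicit Arguments.
Unset Strict Implicit.
Unset Printing Implicit Defensive.

Import Order.TTheory GRing.Theory Num.Theory.
Import numFieldNormedType.Exports.

Local Open Scope classical_set_scope.
Local Open Scope ring_scope.

(* The complex numbers, packaged so that the norm topology of a numFieldType
   is found on them (it is not, on the bare type R[i]). *)
Definition C (R : realType) : numClosedFieldType := R[i]%C.

(* At every point z0 near 0, F is the sum of a power series centred at z0. *)
Definition analytic_near0 (R : realType) (n : nat) (F : C R -> 'M[C R]_n) :=
  \forall z0 \near nbhs (0 : C R), exists c : nat -> 'M[C R]_n,
    \forall z \near nbhs (z0 : C R),
      series (fun m => (z - z0) ^+ m *: c m) @ \oo --> F z.

Section LinearAlgebra.
Variable K : numClosedFieldType.

Definition ctrmx (m p : nat) (A : 'M[K]_(m, p)) : 'M[K]_(p, m) :=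
  map_mx Num.conj A^T.

(* The values lie in K; they are real and nonnegative. *)
Definition norm2 (m : nat) (v : 'cV[K]_m) : K :=
  sqrtC (\sum_i `|v i ord0| ^+ 2).

Definition normF (m p : nat) (A : 'M[K]_(m, p)) : K :=
  sqrtC (\sum_i \sum_j `|A i j| ^+ 2).

Definition add_row0 (m p : nat) (A : 'M[K]_(m, p)) : 'M[K]_(m.+1, p) :=
  castmx (addn1 m, erefl p) (col_mx A (0 : 'M[K]_(1, p))).

Definition add_col (m p : nat) (A : 'M[K]_(m, p)) (v : 'cV[K]_m) :
    'M[K]_(m, p.+1) :=
  castmx (erefl m, addn1 p) (row_mx A v).

(* The rows of a matrix with m * n rows are grouped into m consecutive blocks
   of height n, with the indexing used by the Kronecker product *t :
   mxtens_index (i, r) is row r of block i. *)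
Definition block (n m p : nat) (Q : 'M[K]_(m * n, p)) (i : 'I_m) (j : 'I_p) :
    'cV[K]_n :=
  \col_r Q (mxtens_index (i, r)) j.

Definition stack (n m : nat) (v : 'I_m -> 'cV[K]_n) : 'cV[K]_(m * n) :=
  \col_p v (mxtens_unindex p).1 (mxtens_unindex p).2 ord0.

Definition add_block0 (n m p : nat) (Q : 'M[K]_(m * n, p)) :
    'M[K]_(m.+1 * n, p) :=
  castmx (esym (mulSnr m n), erefl p) (col_mx Q (0 : 'M[K]_(n, p))).

Definition cols (n p : nat) (Z : 'M[K]_(n, p)) : seq 'cV[K]_n :=
  [seq col l Z | l : 'I_p].

Definition represents_factorization (n k : nat) (Q : 'M[K]_(k.+1 * n, k.+1))
    (a : 'I_k.+1 -> 'I_k.+1 -> 'I_k.+1 -> K) (Z : 'M[K]_(n, k.+1)) : Prop :=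
  [/\ ctrmx Z *m Z = 1%:M,
      basis_of <<[seq block Q ord0 j | j : 'I_k.+1]>>%VS (cols Z) &
      forall i j, block Q i j = \sum_l a i j l *: col l Z].

(* ord0 (resp. ord_max) is the index unlift ord0 (resp. unlift ord_max) sends
   to None. For j = ord_max the coefficient in expand_a is f / beta whatever i
   and l are; otherwise it is 0 as soon as i or l is ord_max. *)
Definition coef_g (k : nat) (a : 'I_k.+1 -> 'I_k.+1 -> 'I_k.+1 -> K)
    (t : 'I_k.+2 -> K) (i l : 'I_k.+2) : K :=
  match unlift ord0 i, unlift ord_max l with
  | None, _ => t l
  | Some i', Some l' => i'.+1%:R^-1 * a i' ord_max l'
  | Some _, None => 0
  end.

Definition coef_f (k : nat) (a : 'I_k.+1 -> 'I_k.+1 -> 'I_k.+1 -> K)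
    (t : 'I_k.+2 -> K) (h : 'cV[K]_k.+1) (i l : 'I_k.+2) : K :=
  let g_l := \col_i coef_g a t i l in
  match unlift ord_max l with
  | Some l' => (g_l - add_row0 (\matrix_(i, j) a i j l') *m h) i ord0
  | None => g_l i ord0
  end.

Definition expand_a (k : nat) (a : 'I_k.+1 -> 'I_k.+1 -> 'I_k.+1 -> K)
    (f : 'I_k.+2 -> 'I_k.+2 -> K) (beta : K) (i j l : 'I_k.+2) : K :=
  match unlift ord_max j, unlift ord_max i, unlift ord_max l with
  | None, _, _ => beta^-1 * f i l
  | Some j', Some i', Some l' => a i' j' l'
  | Some _, _, _ => 0
  end.

End LinearAlgebra.

(* The Hessenberg matrices H_k are left out: they are an output of the
   infinite Arnoldi method that no later iteration reads. *)
Section IAR.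
Variables (R : realType) (n : nat) (M : C R -> 'M[C R]_n).

Section Iteration.
Variables (k : nat) (Q : 'M[C R]_(k.+1 * n, k.+1)).

(* All the y_j but the first: iar_ytail i is y_{i+2} for the 0-based i. *)
Definition iar_ytail (i : 'I_k.+1) : 'cV[C R]_n :=
  i.+1%:R^-1 *: block Q i ord_max.

Definition iar_y1 : 'cV[C R]_n :=
  - (invmx (M 0) *m \sum_(i < k.+1) (derive1n i.+1 M 0 *m iar_ytail i)).

Definition iar_y (j : 'I_k.+2) : 'cV[C R]_n :=
  if unlift ord0 j is Some i then iar_ytail i else iar_y1.

Definition iar_h : 'cV[C R]_k.+1 := ctrmx (add_block0 Q) *m stack iar_y.

Definition iar_yperp : 'cV[C R]_(k.+2 * n) :=
  stack iar_y - add_block0 Q *m iar_h.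

Definition iar_beta : C R := norm2 iar_yperp.

Definition iar_next : 'M[C R]_(k.+2 * n, k.+2) :=
  add_col (add_block0 Q) (iar_beta^-1 *: iar_yperp).

End Iteration.

(* iar_Q x1 k is the basis matrix after k iterations, i.e. Q_{k+1}.
   As 0^-1 = 0, an iteration that breaks down (iar_beta = 0) appends a zero
   column; such a matrix has no factorization, because the orthonormal columns
   of Z would have to be a basis of the span of its first blocks. *)
Fixpoint iar_Q (x1 : 'cV[C R]_n) (k : nat) : 'M[C R]_(k.+1 * n, k.+1) :=
  match k with
  | 0 => stack (fun _ : 'I_1 => (norm2 x1)^-1 *: x1)
  | k'.+1 => iar_next (iar_Q x1 k')
  end.

End IAR.

(* Main.v *)
(** Every block of Q_k, padded by a zero block row, and every y_i is a
    combination of the orthonormal vectors z_1, ..., z_{k+1}, so inner products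
    and norms of block vectors reduce, block by block, to those of the
    coefficient vectors. For the factorization of Q_{k+1}, the (1, k+1)
    coefficient of f is t_{k+1}, which is nonzero because y_1 is not in the span
    of z_1, ..., z_k. Hence beta <> 0, and z_{k+1} lies in the span of the first
    block row of Q_{k+1}. *)
Require Import Defs.
From HB Require Import structures.
From mathcomp Require Import all_boot all_order all_algebra.
From mathcomp Require Import all_classical all_reals all_analysis.
From mathcomp Require Import complex mxtens.

Set Implicit Arguments.
Unset Strict Implicit.
Unset Printing Implicit Defensive.

Import Order.TTheory GRing.Theory Num.Theory.
Import numFieldNormedType.Exports.

Local Open Scope ring_scope.

(** * Splitting off the last index *)

Lemma widen_ord_lift (m : nat) (i : 'I_m) :
  widen_ord (leqnSn m) i = lift ord_max i.
Proof. by apply: ord_inj; rewrite lift_max. Qed.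

(** Shaped for [elim/]: the two cases match the branches of [unlift ord_max], on which the
    coefficient arrays are defined. *)
Lemma ord_maxP (m : nat) (P : 'I_m.+1 -> Prop) :
  (forall i, P (lift ord_max i)) -> P ord_max -> forall i, P i.
Proof. by move=> Pl Pm i; case: (unliftP ord_max i) => [j|] ->. Qed.

(** * Blocks of stacked vectors, padding, and blockwise inner products *)

Section Blocks.
Variable K : numClosedFieldType.

Lemma big_ord_lift_max (V : nmodType) (m : nat) (F : 'I_m.+1 -> V) :
  \sum_i F i = \sum_i F (lift ord_max i) + F ord_max.
Proof.
by rewrite big_ord_recr; under eq_bigr do rewrite widen_ord_lift.
Qed.

Lemma add_row0_lift (m p : nat) (A : 'M[K]_(m, p)) i j :
  add_row0 A (lift ord_max i) j = A i j.
Proof.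
rewrite castmxE /= -(col_mxEu A (0 : 'M[K]_(1, p))); congr (col_mx _ _ _ _).
  by apply: ord_inj; exact: lift_max.
exact: val_inj.
Qed.

Lemma add_row0_max (m p : nat) (A : 'M[K]_(m, p)) j :
  add_row0 A ord_max j = 0.
Proof.
rewrite castmxE /= (_ : cast_ord _ ord_max = rshift m ord0).
  by rewrite col_mxEd mxE.
by apply: val_inj; rewrite /= addn0.
Qed.

Lemma col_add_col_lift (m p : nat) (A : 'M[K]_(m, p)) v j :
  col (lift ord_max j) (add_col A v) = col j A.
Proof.
apply/colP=> i; rewrite mxE [RHS]mxE castmxE -(row_mxEl A v) /=.
congr (row_mx _ _ _ _); first exact: val_inj.
by apply: ord_inj; exact: lift_max.
Qed.

Lemma col_add_col_max (m p : nat) (A : 'M[K]_(m, p)) v :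
  col ord_max (add_col A v) = v.
Proof.
apply/colP=> i; rewrite mxE castmxE /= -(row_mxEr A v).
by congr (row_mx _ _ _ _); apply: val_inj; rewrite /= ?addn0.
Qed.

Lemma block_col (n m p : nat) (Q : 'M[K]_(m * n, p)) i j :
  block Q i j = block (col j Q) i ord0.
Proof. by apply/colP=> r; rewrite !mxE. Qed.

Lemma block_inj (n m : nat) (u v : 'cV[K]_(m * n)) :
  (forall i, block u i ord0 = block v i ord0) -> u = v.
Proof.
move=> eq_uv; apply/colP=> s; case: (mxtens_indexP s) => i r.
by move/colP: (eq_uv i) => /(_ r); rewrite !mxE.
Qed.

Lemma block_stack (n m : nat) (v : 'I_m -> 'cV[K]_n) i :
  block (stack v) i ord0 = v i.
Proof. by apply/colP=> r; rewrite !mxE mxtens_indexK. Qed.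

Lemma blockB (n m p : nat) (A B : 'M[K]_(m * n, p)) i j :
  block (A - B) i j = block A i j - block B i j.
Proof. by apply/colP=> r; rewrite !mxE. Qed.

Lemma blockZ (n m p : nat) (c : K) (A : 'M[K]_(m * n, p)) i j :
  block (c *: A) i j = c *: block A i j.
Proof. by apply/colP=> r; rewrite !mxE. Qed.

Lemma block_sum (I : finType) (n m p : nat) (A : I -> 'M[K]_(m * n, p)) i j :
  block (\sum_x A x) i j = \sum_x block (A x) i j.
Proof.
by apply/colP=> r; rewrite mxE !summxE; apply: eq_bigr => x _; rewrite mxE.
Qed.

Lemma block_tensmx (n m : nat) (u : 'cV[K]_m) (v : 'cV[K]_n) i :
  block (u *t v : 'cV[K]_(m * n)) i ord0 = u i ord0 *: v.
Proof.
apply/colP=> r; rewrite !mxE mxtens_indexK /=.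
by congr (u _ _ * v _ _); apply: val_inj.
Qed.

Lemma block_add_block0_lift (n m p : nat) (Q : 'M[K]_(m * n, p)) i j :
  block (add_block0 Q) (lift ord_max i) j = block Q i j.
Proof.
apply/colP=> r; rewrite !mxE castmxE /= -(col_mxEu Q (0 : 'M[K]_(n, p))).
congr (col_mx _ _ _ _); last exact: val_inj.
by apply: ord_inj; rewrite /= /bump leqNgt ltn_ord.
Qed.

Lemma block_add_block0_max (n m p : nat) (Q : 'M[K]_(m * n, p)) j :
  block (add_block0 Q) ord_max j = 0.
Proof.
apply/colP=> r; rewrite !mxE castmxE /= cast_ord_id.
rewrite (_ : cast_ord _ _ = rshift (m * n) r) ?col_mxEd ?mxE //.
exact: val_inj.
Qed.

Lemma sum_block (V : nmodType) (n m : nat) (F : 'I_(m * n) -> V) :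
  \sum_s F s = \sum_i \sum_r F (mxtens_index (i, r)).
Proof.
rewrite pair_big; rewrite (reindex (@mxtens_index m n)) /=.
  by apply: eq_bigr => -[].
by exists (@mxtens_unindex m n) => s _; rewrite (mxtens_indexK, mxtens_unindexK).
Qed.

Lemma ctrmx_mulE (m p : nat) (A : 'M[K]_(m, p)) (v : 'cV[K]_m) j :
  (ctrmx A *m v) j ord0 = \sum_i (A i j)^* * v i ord0.
Proof. by rewrite mxE; apply: eq_bigr => i _; rewrite !mxE. Qed.

Lemma ctrmxM (m q s : nat) (A : 'M[K]_(m, q)) (B : 'M[K]_(q, s)) :
  ctrmx (A *m B) = ctrmx B *m ctrmx A.
Proof. by rewrite /ctrmx trmx_mul map_mxM. Qed.

Lemma norm2_sqr (m : nat) (v : 'cV[K]_m) :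
  norm2 v ^+ 2 = (ctrmx v *m v) ord0 ord0.
Proof.
rewrite sqrtCK ctrmx_mulE; apply: eq_bigr => i _.
by rewrite normCK mulrC.
Qed.

(** Brings the inner products that form [h] down to blocks in K^n, where orthonormality of the
    columns of [Z] can be used. *)
Lemma ctrmx_mul_block (n m p : nat) (Q : 'M[K]_(m * n, p))
    (v : 'cV[K]_(m * n)) j :
  (ctrmx Q *m v) j ord0 =
  \sum_i (ctrmx (block Q i j) *m block v i ord0) ord0 ord0.
Proof.
rewrite ctrmx_mulE sum_block; apply: eq_bigr => i _.
by rewrite ctrmx_mulE; apply: eq_bigr => r _; rewrite !mxE.
Qed.

Lemma block_mulmx (n m p : nat) (Q : 'M[K]_(m * n, p)) (v : 'cV[K]_p) i :
  block (Q *m v) i ord0 = \sum_j v j ord0 *: block Q i j.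
Proof.
apply/colP=> r; rewrite mxE mxE summxE.
by apply: eq_bigr => j _; rewrite !mxE mulrC.
Qed.

Lemma norm2_block (n m : nat) (v : 'cV[K]_(m * n)) :
  norm2 v = sqrtC (\sum_i norm2 (block v i ord0) ^+ 2).
Proof.
rewrite {1}/norm2 sum_block; congr sqrtC; apply: eq_bigr => i _.
by rewrite sqrtCK; apply: eq_bigr => r _; rewrite !mxE.
Qed.

End Blocks.

(** * Orthonormal columns and norms *)

Section Orthonormal.
Variables (K : numClosedFieldType) (n p : nat) (Z : 'M[K]_(n, p)).
Hypothesis Z_orth : ctrmx Z *m Z = 1%:M.

Lemma sum_colE (c : 'I_p -> K) : \sum_l c l *: col l Z = Z *m \col_l c l.
Proof.
apply/colP=> r; rewrite summxE mxE.
by apply: eq_bigr => l _; rewrite !mxE mulrC.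
Qed.

(** The Gram matrix of [Z] cancels in the middle, so inner products in K^n become inner products of
    coefficient vectors. *)
Lemma dot_orthonormal (c d : 'cV[K]_p) :
  ctrmx (Z *m c) *m (Z *m d) = ctrmx c *m d.
Proof. by rewrite ctrmxM -mulmxA (mulmxA _ Z) Z_orth mul1mx. Qed.

(** Multiplying a vanishing combination by the conjugate transpose of [Z] returns its
    coefficients. *)
Lemma free_cols : free (cols Z).
Proof.
(* [freeP] speaks of tuples; the sequence underlying this one is [cols Z] by conversion. *)
suff : free [tuple col l Z | l < p] by [].
apply/freeP=> c; under eq_bigr do rewrite -tnth_nth tnth_mktuple.
rewrite sum_colE => Zc0 l.
have: ctrmx Z *m (Z *m \col_l c l) = 0 by rewrite Zc0 mulmx0.
by rewrite mulmxA Z_orth mul1mx => /colP/(_ l); rewrite !mxE.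
Qed.

End Orthonormal.

Lemma mem_cols (K : numClosedFieldType) (n p : nat) (Z : 'M[K]_(n, p)) l :
  col l Z \in <<cols Z>>%VS.
Proof. by apply/memv_span/map_f; rewrite mem_enum. Qed.

(** A vanishing sum of nonnegative terms vanishes termwise, first over the rows, then within row
    [i]. A single nonzero coefficient thus suffices for beta <> 0. *)
Lemma normF_eq0 (K : numClosedFieldType) (m p : nat) (A : 'M[K]_(m, p)) i j :
  normF A = 0 -> A i j = 0.
Proof.
move/eqP; rewrite sqrtC_eq0 => /eqP A0.
have /psumr_eq0P/(_ A0 i isT) Ai0 : forall i, true ->
    0 <= \sum_j `|A i j| ^+ 2 :> K.
  by move=> ? _; apply: sumr_ge0 => ? _; rewrite exprn_ge0.
have /psumr_eq0P/(_ Ai0 j isT) : forall j, true -> 0 <= `|A i j| ^+ 2 :> K.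
  by move=> ? _; rewrite exprn_ge0.
by move/eqP; rewrite expf_eq0 /= normr_eq0 => /eqP.
Qed.

(** * Coefficient arrays: padding, expansion, g and f *)

Section Coefficients.
Variables (K : numClosedFieldType) (k : nat).
Variable a : 'I_k.+1 -> 'I_k.+1 -> 'I_k.+1 -> K.

(* The coefficients of Q_k with one zero block row appended, with respect to
   one more basis vector z_{k+1}. *)
Definition pad_a (i : 'I_k.+2) (j : 'I_k.+1) (l : 'I_k.+2) : K :=
  match unlift ord_max i, unlift ord_max l with
  | Some i', Some l' => a i' j l'
  | _, _ => 0
  end.

Lemma pad_aE i j l : pad_a (lift ord_max i) j (lift ord_max l) = a i j l.
Proof. by rewrite /pad_a !liftK. Qed.

Lemma pad_a_maxl j l : pad_a ord_max j l = 0.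
Proof. by rewrite /pad_a unlift_none. Qed.

Lemma pad_a_maxr i j : pad_a i j ord_max = 0.
Proof. by rewrite /pad_a unlift_none; case: unlift. Qed.

Lemma expand_a_lift f beta i j l :
  expand_a a f beta i (lift ord_max j) l = pad_a i j l.
Proof. by rewrite /expand_a liftK. Qed.

Lemma expand_a_max f beta i l :
  expand_a a f beta i ord_max l = beta^-1 * f i l.
Proof. by rewrite /expand_a unlift_none. Qed.

Lemma coef_g_lift_max t i : coef_g a t (lift ord0 i) ord_max = 0.
Proof. by rewrite /coef_g liftK unlift_none. Qed.

Lemma coef_g_lift t i l :
  coef_g a t (lift ord0 i) (lift ord_max l) = i.+1%:R^-1 * a i ord_max l.
Proof. by rewrite /coef_g !liftK. Qed.

Lemma coef_g0 t l : coef_g a t ord0 l = t l.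
Proof. by rewrite /coef_g unlift_none. Qed.

(** One formula for both branches of [coef_f]: the padding supplies the zero row, and for the last
    [l] it makes the subtracted sum zero. *)
Lemma coef_fE t h i l :
  coef_f a t h i l = coef_g a t i l - \sum_j pad_a i j l * h j ord0.
Proof.
elim/ord_maxP: l => [l|]; rewrite /coef_f.
  rewrite liftK !mxE; congr (_ - _); apply: eq_bigr => j _; congr (_ * _).
  elim/ord_maxP: i => [i|]; last by rewrite add_row0_max pad_a_maxl.
  by rewrite add_row0_lift pad_aE mxE.
rewrite unlift_none mxE big1 ?subr0 // => j _.
by rewrite pad_a_maxr mul0r.
Qed.

Variables (n : nat) (Z : 'M[K]_(n, k.+1)) (Q : 'M[K]_(k.+1 * n, k.+1)).
Hypothesis QE : forall i j, block Q i j = \sum_l a i j l *: col l Z.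

(** Any [z] is allowed, because its coefficients in the padded array are all zero. *)
Lemma block_pad (z : 'cV[K]_n) i j :
  block (add_block0 Q) i j = \sum_l pad_a i j l *: col l (add_col Z z).
Proof.
rewrite big_ord_lift_max pad_a_maxr scale0r addr0.
elim/ord_maxP: i => [i|]; last first.
  by rewrite block_add_block0_max big1 // => l _; rewrite pad_a_maxl scale0r.
rewrite block_add_block0_lift QE; apply: eq_bigr => l _.
by rewrite pad_aE col_add_col_lift.
Qed.

End Coefficients.

(** * One iteration of the method, carried out on coefficients *)

Theorem theorem3p2 (R : realType) (n : nat) (M : C R -> 'M[C R]_n)
    (x1 : 'cV[C R]_n)
    (M_analytic : analytic_near0 M)
    (M0_unit : M 0 \in unitmx)
    (x1_neq0 : x1 != 0)
    (k : nat)
    (a : 'I_k.+1 -> 'I_k.+1 -> 'I_k.+1 -> C R) (Z : 'M[C R]_(n, k.+1))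
    (aZ_fact : represents_factorization (iar_Q M x1 k) a Z) :
  let Q := iar_Q M x1 k in
  let y := iar_y M Q in
  let h := iar_h M Q in
  let yperp := iar_yperp M Q in
  let beta := iar_beta M Q in
  (let A := (\matrix_(i, l) a i ord_max l)^T in
   forall j : 'I_k.+1, y (lift ord0 j) = j.+1%:R^-1 *: col j (Z *m A)) /\
  (y ord0 \notin <<cols Z>>%VS ->
   forall (z : 'cV[C R]_n) (t : 'I_k.+2 -> C R),
   let Z' := add_col Z z in
   y ord0 = \sum_l t l *: col l Z' ->
   ctrmx Z' *m Z' = 1%:M ->
   let g := coef_g a t in
   let f := coef_f a t h in
   [/\ h = \sum_(l < k.+1)
             (\matrix_(j, i) (a i j l)^*) *m
             (\col_(i < k.+1) g (widen_ord (leqnSn _) i)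
                                (widen_ord (leqnSn _) l)),
       yperp = \sum_(l < k.+2) (\col_i f i l) *t col l Z',
       beta = normF (\matrix_(i, l) f i l) &
       represents_factorization (iar_Q M x1 k.+1) (expand_a a f beta) Z']).
Proof.
move=> Q; have [_ Z_basis QE] := aZ_fact; rewrite -/Q in Z_basis QE.
move=> y h yperp beta.
have y_tail j : y (lift ord0 j) = j.+1%:R^-1 *: block Q j ord_max.
  by rewrite /y /iar_y liftK.
split=> [A j|y1_notin z t Z' y1E Z'_orth g f].
  rewrite y_tail QE sum_colE colE -mulmxA -colE; congr (_ *: (_ *m _)).
  by apply/colP=> l; rewrite !mxE.
(* The first block is expanded by the choice of [t]; the others come from the last column of Q_k and
   have no component along [z]. *)
have yE i : y i = \sum_l g i l *: col l Z'.
  case: (unliftP ord0 i) => [j|] ->; last first.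
    by rewrite y1E; apply: eq_bigr => l _; rewrite /g coef_g0.
  rewrite big_ord_lift_max /g coef_g_lift_max scale0r addr0 y_tail QE scaler_sumr.
  by apply: eq_bigr => l _; rewrite coef_g_lift scalerA col_add_col_lift.
have padE := block_pad QE z.
(* Orthonormality of [Z'] is applied in each block separately. *)
have hE j : h j ord0 = \sum_i \sum_l (pad_a a i j l)^* * g i l.
  rewrite ctrmx_mul_block; apply: eq_bigr => i _.
  rewrite padE block_stack -/y yE !sum_colE dot_orthonormal // ctrmx_mulE.
  by apply: eq_bigr => l _; rewrite !mxE.
(* Exchanging the sums over columns and basis vectors collects the coefficient of each z_l, which is
   f_{i,l}. *)
have yperpE i : block yperp i ord0 = \sum_l f i l *: col l Z'.
  rewrite blockB block_stack block_mulmx -/y yE.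
  under [X in _ - X]eq_bigr do rewrite padE scaler_sumr.
  rewrite exchange_big -sumrB; apply: eq_bigr => l _.
  rewrite /f coef_fE scalerBl scaler_suml; congr (_ - _).
  by apply: eq_bigr => j _; rewrite scalerA mulrC.
have betaE : beta = normF (\matrix_(i, l) f i l).
  rewrite /beta /iar_beta norm2_block; congr sqrtC; apply: eq_bigr => i _.
  rewrite yperpE sum_colE norm2_sqr dot_orthonormal // -norm2_sqr sqrtCK.
  by apply: eq_bigr => l _; rewrite !mxE.
have t_neq0 : t ord_max != 0.
  apply: contraNneq y1_notin => t0.
  rewrite y1E big_ord_lift_max t0 scale0r addr0.
  by apply: memv_suml => l _; rewrite col_add_col_lift memvZ ?mem_cols.
(* Orthogonalization leaves this entry unchanged: the columns of Q_k have no component along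
   z_{k+1}. *)
have f_max : f ord0 ord_max = t ord_max.
  rewrite /f coef_fE coef_g0 big1 ?subr0 // => j _.
  by rewrite pad_a_maxr mul0r.
have beta_neq0 : beta != 0.
  apply: contraNneq t_neq0; rewrite betaE -f_max => /normF_eq0 f0.
  by have := f0 ord0 ord_max; rewrite mxE => ->.
split=> //.
(* The terms with i = k+1 or l = k+1 vanish by the padding, which leaves the sums up to k of the
   statement. *)
- apply/colP=> j; rewrite hE big_ord_lift_max [X in _ + X]big1 ?addr0; last first.
    by move=> l _; rewrite pad_a_maxl rmorph0 mul0r.
  under eq_bigr do rewrite big_ord_lift_max pad_a_maxr rmorph0 mul0r addr0.
  rewrite exchange_big summxE; apply: eq_bigr => l _.
  by rewrite mxE; apply: eq_bigr => i _; rewrite !mxE pad_aE !widen_ord_lift.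
- apply: block_inj => i; rewrite yperpE block_sum; apply: eq_bigr => l _.
  by rewrite block_tensmx mxE.
have nextE i j : block (iar_Q M x1 k.+1) i j =
    \sum_l expand_a a f beta i j l *: col l Z'.
  elim/ord_maxP: j => [j|]; rewrite block_col.
    rewrite col_add_col_lift -block_col padE.
    by apply: eq_bigr => l _; rewrite expand_a_lift.
  rewrite col_add_col_max blockZ yperpE scaler_sumr.
  by apply: eq_bigr => l _; rewrite expand_a_max scalerA.
split=> //; apply/andP; split; last exact: free_cols.
(* [W] is the span of the first block row of Q_{k+1}; it must equal the span of the columns of
   [Z']. *)
set W := (X in _ == X).
have mem_next j : block (iar_Q M x1 k.+1) ord0 j \in W.
  by apply/memv_span/map_f; rewrite mem_enum.
(* The zero block row is appended at the bottom, so the first blocks of Q_k, which span z_1, ...,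
   z_k, reappear in Q_{k+1}. *)
have mem_lift l : col (lift ord_max l) Z' \in W.
  rewrite col_add_col_lift; have := mem_cols Z l; rewrite (span_basis Z_basis).
  apply/subvP/span_subvP => _ /mapP[j _ ->].
  suff -> : block Q ord0 j = block (iar_Q M x1 k.+1) ord0 (lift ord_max j).
    exact: mem_next.
  rewrite [RHS]block_col col_add_col_lift -block_col.
  by rewrite -block_add_block0_lift; congr (block _ _ _); apply: val_inj.
rewrite eqEsubv; apply/andP; split; apply/span_subvP => _ /mapP[j _ ->].
  elim/ord_maxP: j => //.
  (* The first block of the new column lies in [W]. Removing its components along z_1, ..., z_k
     leaves (t_{k+1} / beta) z_{k+1}, whose scalar is nonzero. *)
  have := mem_next ord_max; rewrite nextE big_ord_lift_max expand_a_max f_max.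
  rewrite rpredDl => [|]; last by apply: memv_suml => l _; rewrite memvZ.
  by rewrite rpredZeq mulf_eq0 invr_eq0 (negPf beta_neq0) (negPf t_neq0).
(* Conversely, each first block is a combination of the columns of [Z']. *)
by rewrite nextE memv_suml // => l _; rewrite memvZ ?mem_cols.
Qed.
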